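(* Let $0<\rho<\sigma<1$, $0\le\eta<\frac{1-\sigma}{1+\sigma}$, and let $G_1,\dots,G_m:\mathbb{R}^n\to\mathcal{I}(\mathbb{R})$ be $gH$-continuously differentiable interval-valued maps. Let $(x^k),(d^k),(t_k),(\beta_k)$ be infinite sequences generated by the nonlinear conjugate gradient scheme described in the context, and let $L_0=\{x\in\mathbb{R}^n: G_i(x)\preceq G_i(x^0)\text{ for all }i=1,\dots,m\}$. Assume: (1) for each $i=1,\dots,m$, $\nabla_{gH}G_i$ is $gH$-Lipschitz continuous on $L_0$ with some constant $L_i$; (2) for every sequence $(y^k)$ in $L_0$ with $G_i(y^{k+1})\preceq G_i(y^k)$ for all $k$ and all $i=1,\dots,m$, there exist $\mathcal{G}_1,\dots,\mathcal{G}_m\in\mathcal{I}(\mathbb{R})$ such that $\mathcal{G}_i\preceq G_i(y^k)$ for all $k$ and all $i$. Suppose that for all $k\ge1$ $$\beta_k=\eta\,\beta_k^{DY},\qquad \beta_k^{DY}:=\frac{-\psi\circ\phi_{x^k}(v(x^k))}{\psi\circ\phi_{x^k}(d^{k-1})-\psi\circ\phi_{x^{k-1}}(d^{k-1})}.$$ If $t_k$ satisfies the strong Wolfe conditions for all $k\ge0$, then $\liminf_{k\to\infty}\|v(x^k)\|=0$.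
   Context: $\|\cdot\|$ is the Euclidean norm. $\mathcal{I}(\mathbb{R})$ is the set of closed bounded intervals of $\mathbb{R}$. For $A=[a_1,a_2]$, $B=[b_1,b_2]$ in $\mathcal{I}(\mathbb{R})$ and $\alpha\in\mathbb{R}$: $A\oplus B=[a_1+b_1,a_2+b_2]$; $\alpha\odot A=A\odot\alpha=[\min\{\alpha a_1,\alpha a_2\},\max\{\alpha a_1,\alpha a_2\}]$; $A\preceq B$ means $a_1\le b_1$ and $a_2\le b_2$. Write $G_i=[\underline{G}_i,\overline{G}_i]$ with real-valued endpoint functions $\underline{G}_i\le\overline{G}_i$. ''$gH$-continuously differentiable'' means that the endpoint functions are differentiable and the $gH$-gradient $\nabla_{gH}G_i(x)$ is continuous in $x$, where $\nabla_{gH}G_i(x)$ is the vector of intervals whose $j$-th component is $[\underline{\nabla_{gH}G_i}(x)_j,\overline{\nabla_{gH}G_i}(x)_j]$ with $$\underline{\nabla_{gH}G_i}(x)_j=\min\{\partial_j\underline{G}_i(x),\partial_j\overline{G}_i(x)\},\qquad \overline{\nabla_{gH}G_i}(x)_j=\max\{\partial_j\underline{G}_i(x),\partial_j\overline{G}_i(x)\};$$ continuity means that the maps $\underline{\nabla_{gH}G_i},\overline{\nabla_{gH}G_i}:\mathbb{R}^n\to\mathbb{R}^n$ are continuous, and $gH$-Lipschitz continuity of $\nabla_{gH}G_i$ on $L_0$ with constant $L_i$ means that both of these maps are Lipschitz on $L_0$ with constant $L_i$ (Euclidean norm). For $x,v\in\mathbb{R}^n$, with $|v|=(|v_1|,\dots,|v_n|)^\top$,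 $$\psi\circ\phi_x(v):=\max_{1\le i\le m}\Big[\tfrac12\big(\underline{\nabla_{gH}G_i}(x)+\overline{\nabla_{gH}G_i}(x)\big)^\top v+\tfrac12\big(\overline{\nabla_{gH}G_i}(x)-\underline{\nabla_{gH}G_i}(x)\big)^\top|v|\Big].$$ For $x\in\mathbb{R}^n$, $v(x)$ is the unique minimizer and $\xi(x)$ the minimum value of the strongly convex function $v\mapsto\psi\circ\phi_x(v)+\tfrac12\|v\|^2$ over $\mathbb{R}^n$. Nonlinear conjugate gradient scheme: given $x^0\in\mathbb{R}^n$ and real parameters $\beta_k$ ($k\ge1$), $d^0=v(x^0)$, $d^k=v(x^k)+\beta_kd^{k-1}$ for $k\ge1$, and $x^{k+1}=x^k+t_kd^k$ with step lengths $t_k>0$. It is assumed throughout that the scheme produces infinite sequences with $\xi(x^k)\ne0$ and $v(x^k)\neq0$ for all $k$ (no stopping). Strong Wolfe conditions for $t_k$: $G_i(x^k+t_kd^k)\preceq G_i(x^k)\oplus[\rho t_k,\rho t_k]\odot\psi\circ\phi_{x^k}(d^k)$ for $i=1,\dots,m$, and $|\psi\circ\phi_{x^k+t_kd^k}(d^k)|\le\sigma\,|\psi\circ\phi_{x^k}(d^k)|$. *)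

(* Defs.v *)
From HB Require Import structures.
From mathcomp Require Import all_boot all_order all_algebra.
From mathcomp Require Import all_classical all_reals all_analysis.

Set Implicit Arguments.
Unset Strict Implicit.
Unset Printing Implicit Defensive.

Import Order.TTheory GRing.Theory Num.Theory.
Import numFieldNormedType.Exports.

Local Open Scope classical_set_scope.
Local Open Scope ring_scope.

Section Intervals.
Context {R : realType}.

(* A (nonempty) closed bounded interval [lo, hi], given by its endpoints. *)
Record cbi : Type := Cbi { lo : R; hi : R; lo_le_hi : lo <= hi }.

Implicit Types A B : cbi.

Lemma cbi_add_subproof A B : lo A + lo B <= hi A + hi B.
Proof. by rewrite lerD ?lo_le_hi. Qed.

Definition cbi_add A B : cbi := Cbi (cbi_add_subproof A B).

Lemma min_le_max (a b : R) : Num.min a b <= Num.max a b.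
Proof. by rewrite ge_min !le_max lexx. Qed.

Definition cbi_hull (a b : R) : cbi := Cbi (min_le_max a b).

Definition cbi_scale (a : R) A : cbi := cbi_hull (a * lo A) (a * hi A).

Definition cbi_pt (a : R) : cbi := Cbi (lexx a).

Definition cbi_le A B : Prop := lo A <= lo B /\ hi A <= hi B.

End Intervals.
Arguments cbi : clear implicits.

Section Euclidean.
Context {R : realType} {n : nat}.
Implicit Types u v : 'rV[R]_n.

Definition dotp u v : R := \sum_j u 0 j * v 0 j.

(* The library norm on 'rV[R]_n is the sup norm; it induces the same topology
   but not the same Lipschitz constants, hence this separate definition. *)
Definition enorm u : R := Num.sqrt (\sum_j u 0 j ^+ 2).

Definition elipschitz_on (S : set 'rV[R]_n) (L : R) (f : 'rV[R]_n -> 'rV[R]_n) :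
  Prop :=
  forall x y, S x -> S y -> enorm (f x - f y) <= L * enorm (x - y).

End Euclidean.

Section GHGradient.
Context {R : realType} {n : nat}.
Implicit Type F : 'rV[R]_n -> cbi R.

Definition partial (f : 'rV[R]_n -> R) (x : 'rV[R]_n) (j : 'I_n) : R :=
  'D_(delta_mx 0 j) f x.

Definition gH_gradient F (x : 'rV[R]_n) : 'rV[cbi R]_n :=
  \row_j cbi_hull (partial (lo \o F) x j) (partial (hi \o F) x j).

Definition gH_grad_lo F (x : 'rV[R]_n) : 'rV[R]_n := map_mx lo (gH_gradient F x).
Definition gH_grad_hi F (x : 'rV[R]_n) : 'rV[R]_n := map_mx hi (gH_gradient F x).

Definition gH_continuously_differentiable F : Prop :=
  [/\ forall x, differentiable (lo \o F) x,
      forall x, differentiable (hi \o F) x,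
      continuous (gH_grad_lo F) & continuous (gH_grad_hi F)].

Definition gH_grad_lipschitz_on (S : set 'rV[R]_n) (L : R) F : Prop :=
  elipschitz_on S L (gH_grad_lo F) /\ elipschitz_on S L (gH_grad_hi F).

End GHGradient.

(* A family G_1, ..., G_p with p >= 1 is indexed by 'I_m.+1, where p = m.+1, so
   that the maximum below is over a nonempty set. *)
Section Direction.
Context {R : realType} {m n : nat}.
Variable G : 'I_m.+1 -> 'rV[R]_n -> cbi R.
Implicit Types x v : 'rV[R]_n.

Definition phi x v (i : 'I_m.+1) : R :=
  2^-1 * dotp (gH_grad_lo (G i) x + gH_grad_hi (G i) x) v
  + 2^-1 * dotp (gH_grad_hi (G i) x - gH_grad_lo (G i) x) (map_mx Num.norm v).

(* The base value is one of the terms, so this is the maximum over all i. *)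
Definition psi_phi x v : R := \big[Num.max/phi x v ord0]_(i < m.+1) phi x v i.

Definition objective x v : R := psi_phi x v + 2^-1 * enorm v ^+ 2.

(* [objective x] is strongly convex, so the set below is a singleton and the
   default value 0 of [xget] is irrelevant. *)
Definition vdir x : 'rV[R]_n :=
  xget 0 [set v | forall u, objective x v <= objective x u].

Definition xi x : R := objective x (vdir x).

Definition level_set (x0 : 'rV[R]_n) : set 'rV[R]_n :=
  [set x | forall i, cbi_le (G i x) (G i x0)].

(* Infinite run of the scheme, without stopping; [beta 0] is unused. *)
Definition ncg_scheme (x d : nat -> 'rV[R]_n) (t beta : nat -> R) : Prop :=
  [/\ d 0 = vdir (x 0),
      forall k, d k.+1 = vdir (x k.+1) + beta k.+1 *: d k,
      forall k, x k.+1 = x k + t k *: d k,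
      forall k, 0 < t k &
      forall k, xi (x k) != 0 /\ vdir (x k) != 0].

Definition strong_wolfe (rho sigma : R) x (d : 'rV[R]_n) (t : R) : Prop :=
  (forall i, cbi_le (G i (x + t *: d))
               (cbi_add (G i x) (cbi_scale (psi_phi x d) (cbi_pt (rho * t)))))
  /\ `|psi_phi (x + t *: d) d| <= sigma * `|psi_phi x d|.

(* beta_{k+1}^{DY} *)
Definition betaDY (x d : nat -> 'rV[R]_n) (k : nat) : R :=
  - psi_phi (x k.+1) (vdir (x k.+1))
  / (psi_phi (x k.+1) (d k) - psi_phi (x k) (d k)).

End Direction.

(* Main.v *)
Require Import Defs.
From HB Require Import structures.
From mathcomp Require Import all_boot all_order all_algebra.
From mathcomp Require Import all_classical all_reals all_analysis.
From mathcomp Require Import ring lra.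
Import Order.TTheory GRing.Theory Num.Theory.
Import numFieldNormedType.Exports.
Local Open Scope classical_set_scope.
Local Open Scope ring_scope.

(** Write [p_x] for [psi_phi G x], [v_k] for the minimizing direction at [x_k],
    [w_k = - p_(x_k) (v_k)] and [a_k = - p_(x_k) (d_k)].

    Each [p_x] is sublinear, and comparing the minimizer [v_k] with the
    competitor [0] gives [w_k >= |v_k|^2 / 2].  The second Wolfe condition makes
    the denominator of the Dai-Yuan quotient positive, and its exact value turns
    sublinearity along [d_(k+1) = v_(k+1) + beta_(k+1) d_k] into
      [a_(k+1) >= (1 - eta) w_(k+1) + beta_(k+1) a_k]
    ([dai_yuan_descent]), so that all [a_k] are positive.  The norms obey the
    parallel bound [|d_(k+1)| <= |v_(k+1)| + beta_(k+1) |d_k|].  If [|v_k|]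
    stayed above some [g > 0], then [w_k] would dominate a multiple of [|v_k|],
    and both recursions together would give [|d_k| <= B a_k] for a constant [B]
    ([descent_ratio_bound]).

    On the other hand the second Wolfe condition and the Lipschitz gradients
    give [(1 - sigma) a_k <= K t_k |d_k|^2] ([curvature_step]), which becomes
    [t_k a_k >= (1 - sigma) / (K B^2)].  By the first Wolfe condition the
    endpoints of every [G_i] then decrease by a fixed amount at each step, which
    contradicts boundedness below along the iterates.  This replaces the usual
    summability argument of Zoutendijk type. *)

(** * Euclidean inner product and norm *)

Section EuclideanNorm.
Context {R : realType} {n : nat}.
Implicit Types u v w : 'rV[R]_n.

Lemma dotpC u v : dotp u v = dotp v u.
Proof. by apply: eq_bigr => j _; rewrite mulrC. Qed.

Lemma dotpDr w u v : dotp w (u + v) = dotp w u + dotp w v.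
Proof.
by rewrite -big_split; apply: eq_bigr => j _ /=; rewrite mxE mulrDr.
Qed.

Lemma dotpZr w (a : R) u : dotp w (a *: u) = a * dotp w u.
Proof. by rewrite mulr_sumr; apply: eq_bigr => j _; rewrite mxE mulrCA. Qed.

Lemma dotpNr w u : dotp w (- u) = - dotp w u.
Proof. by rewrite -scaleN1r dotpZr mulN1r. Qed.

Lemma dotpDl w u v : dotp (u + v) w = dotp u w + dotp v w.
Proof. by rewrite dotpC dotpDr !(dotpC w). Qed.

Lemma dotpNl w u : dotp (- u) w = - dotp u w.
Proof. by rewrite dotpC dotpNr dotpC. Qed.

Lemma dotpZl w (a : R) u : dotp (a *: u) w = a * dotp u w.
Proof. by rewrite dotpC dotpZr dotpC. Qed.

Lemma enorm_ge0 u : 0 <= enorm u.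
Proof. exact: sqrtr_ge0. Qed.

Lemma sqr_enorm u : enorm u ^+ 2 = dotp u u.
Proof.
rewrite /enorm sqr_sqrtr; last by apply: sumr_ge0 => j _; exact: sqr_ge0.
by apply: eq_bigr => j _; rewrite expr2.
Qed.

Lemma ler_coord_enorm u j : `|u 0 j| <= enorm u.
Proof.
rewrite -sqrtr_sqr ler_wsqrtr// (bigD1 j)//= lerDl.
by apply: sumr_ge0 => k _; exact: sqr_ge0.
Qed.

Lemma enorm0_eq0 u : enorm u = 0 -> u = 0.
Proof.
move=> u0; apply/rowP => j; rewrite mxE; apply/normr0_eq0/eqP.
by rewrite eq_le normr_ge0 andbT -u0 ler_coord_enorm.
Qed.

Lemma enormZ (a : R) u : enorm (a *: u) = `|a| * enorm u.
Proof.
apply: (@pexpIrn _ 2); rewrite ?nnegrE ?mulr_ge0 ?enorm_ge0//.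
by rewrite exprMn real_normK ?num_real// !sqr_enorm dotpZr dotpZl; ring.
Qed.

Lemma enormN u : enorm (- u) = enorm u.
Proof. by rewrite -scaleN1r enormZ normrN1 mul1r. Qed.

Lemma enorm_norm u : enorm (map_mx Num.norm u) = enorm u.
Proof.
congr Num.sqrt; apply: eq_bigr => j _.
by rewrite mxE real_normK ?num_real.
Qed.

(** Cauchy-Schwarz: the vector [|v| u - |u| v] has nonnegative square norm. *)
Lemma dotp_le_enorm u v : dotp u v <= enorm u * enorm v.
Proof.
have [u0|u0] := eqVneq (enorm u) 0.
  rewrite u0 mul0r (enorm0_eq0 _ u0) -(scale0r (0 : 'rV[R]_n)) dotpZl mul0r.
  exact: lexx.
have [v0|v0] := eqVneq (enorm v) 0.
  rewrite v0 mulr0 (enorm0_eq0 _ v0) -(scale0r (0 : 'rV[R]_n)) dotpZr mul0r.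
  exact: lexx.
have pu : 0 < enorm u by rewrite lt_def u0 enorm_ge0.
have pv : 0 < enorm v by rewrite lt_def v0 enorm_ge0.
have := sqr_ge0 (enorm (enorm v *: u - enorm u *: v)).
rewrite sqr_enorm !(dotpDl, dotpDr, dotpNl, dotpNr, dotpZl, dotpZr).
rewrite -!sqr_enorm (dotpC v u) => h.
have : 0 <= (enorm u * enorm v) * (enorm u * enorm v - dotp u v) by nra.
by rewrite pmulr_rge0 ?mulr_gt0// subr_ge0.
Qed.

Lemma enormD u v : enorm (u + v) <= enorm u + enorm v.
Proof.
rewrite -(@ler_pXn2r _ 2) ?nnegrE ?addr_ge0 ?enorm_ge0//.
rewrite sqr_enorm dotpDl !dotpDr -!sqr_enorm (dotpC v u).
have := dotp_le_enorm u v; nra.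
Qed.

Lemma dotp_abs_le_enorm u v : dotp u (map_mx Num.norm v) <= enorm u * enorm v.
Proof. by rewrite -(enorm_norm v) dotp_le_enorm. Qed.

(** The expression inside the maximum defining [psi_phi], as a function of the
    endpoint gradients.  Bounding the four inner products separately gives
    each endpoint difference the weight [2 * 2^-1]. *)
Lemma interval_dotp_lipschitz l h l' h' v :
  2^-1 * dotp (l + h) v + 2^-1 * dotp (h - l) (map_mx Num.norm v) <=
  2^-1 * dotp (l' + h') v + 2^-1 * dotp (h' - l') (map_mx Num.norm v)
  + (enorm (l - l') + enorm (h - h')) * enorm v.
Proof.
have := dotp_le_enorm (l - l') v; have := dotp_le_enorm (h - h') v.
have := dotp_abs_le_enorm (h - h') v; have := dotp_abs_le_enorm (- (l - l')) v.
rewrite enormN !(dotpDl, dotpNl).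
move: (enorm _) (enorm _) (enorm _) => a b c.
move: (dotp l v) (dotp h v) (dotp l' v) (dotp h' v) => lv hv l'v h'v.
move: (dotp l _) (dotp h _) (dotp l' _) (dotp h' _) => *.
lra.
Qed.

End EuclideanNorm.

(** * The sublinear function [psi_phi] and its minimizing direction *)

Section SupportFunction.
Context {R : realType} {m n : nat}.
Variable G : 'I_m.+1 -> 'rV[R]_n -> cbi R.
Implicit Types x y u v : 'rV[R]_n.

Lemma phi_le_psi_phi x v i : phi G x v i <= psi_phi G x v.
Proof. exact: le_bigmax. Qed.

Lemma psi_phi_le x v (a : R) :
  (forall i, phi G x v i <= a) -> psi_phi G x v <= a.
Proof. by move=> h; apply: bigmax_le => // i _. Qed.

(** The coefficients of [|v_j|] are widths of intervals, hence nonnegative, so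
    the triangle inequality applies coordinatewise. *)
Lemma phi_sublinear x u v (a : R) i : 0 <= a ->
  phi G x (u + a *: v) i <= phi G x u i + a * phi G x v i.
Proof.
move=> a0; rewrite /phi !dotpDr !dotpZr.
set w := gH_grad_hi _ _ - _.
suff : dotp w (map_mx Num.norm (u + a *: v)) <=
    dotp w (map_mx Num.norm u) + a * dotp w (map_mx Num.norm v) by lra.
rewrite -dotpZr -dotpDr; apply: ler_sum => j _.
apply: ler_wpM2l; first by rewrite !mxE subr_ge0 lo_le_hi.
by rewrite !mxE (le_trans (ler_normD _ _))// normrM (ger0_norm a0).
Qed.

Lemma psi_phi_sublinear x u v (a : R) : 0 <= a ->
  psi_phi G x (u + a *: v) <= psi_phi G x u + a * psi_phi G x v.
Proof.
move=> a0; apply: psi_phi_le => i.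
rewrite (le_trans (phi_sublinear _ _ _ _ _ a0))// lerD ?phi_le_psi_phi//.
by rewrite ler_wpM2l// phi_le_psi_phi.
Qed.

Lemma phi0 x i : phi G x 0 i = 0.
Proof.
rewrite /phi /dotp !big1 ?mulr0 ?addr0// => j _; rewrite !mxE ?normr0;
  exact: mulr0.
Qed.

Lemma psi_phi0 x : psi_phi G x 0 = 0.
Proof.
apply/le_anti/andP; split; first by apply: psi_phi_le => i; rewrite phi0.
by rewrite -(phi0 x ord0) phi_le_psi_phi.
Qed.

(** The maximum over [i] inherits any constant that works for all [i]; a sum of
    absolute values is such a constant, and the added [1] makes it positive. *)
Lemma psi_phi_lipschitz (S : set 'rV[R]_n) :
  (forall i, exists L : R, gH_grad_lipschitz_on S L (G i)) ->
  exists2 K : R, 0 < K & forall x y v, S x -> S y ->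
    psi_phi G x v <= psi_phi G y v + K * enorm (x - y) * enorm v.
Proof.
move=> /choice[L HL].
exists (1 + \sum_i 2 * `|L i|).
  by rewrite ltr_wpDr// sumr_ge0// => i _; rewrite mulr_ge0.
move=> x y v Sx Sy; apply: psi_phi_le => i.
have [/(_ _ _ Sx Sy) hlo /(_ _ _ Sx Sy) hhi] := HL i.
apply: le_trans (interval_dotp_lipschitz _ _
  (gH_grad_lo (G i) y) (gH_grad_hi (G i) y) _) _.
apply: lerD; first exact: phi_le_psi_phi.
apply: ler_wpM2r; first exact: enorm_ge0.
rewrite (le_trans (lerD hlo hhi))// -mulrDl ler_wpM2r ?enorm_ge0//.
have -> : L i + L i = 2 * L i by ring.
rewrite (bigD1 i)//= addrCA; apply: ler_wpDr;
  last by rewrite ler_pM2l// ler_norm.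
by rewrite addr_ge0// sumr_ge0// => j _; rewrite mulr_ge0.
Qed.

Lemma continuous_coord (j : 'I_n) : continuous (fun v : 'rV[R]_n => v 0 j).
Proof. exact: coord_continuous. Qed.

Lemma continuous_sumr (T : topologicalType) p (f : 'I_p -> T -> R) :
  (forall j, continuous (f j)) -> continuous (fun z => \sum_j f j z).
Proof.
move=> cf; elim: (index_enum _) => [|j r IH].
  by under eq_fun do rewrite big_nil; move=> z; exact: cvg_cst.
under eq_fun do rewrite big_cons.
by move=> z; apply: cvgD; [exact: cf|exact: IH].
Qed.

Lemma continuous_phi x i : continuous (fun v => phi G x v i).
Proof.
have scal (a : R) (f : 'rV[R]_n -> R) : continuous f ->
    continuous (fun v => a * f v).
  by move=> cf v; exact: (cvgM (cvg_cst a) (cf v)).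
have cabs j : continuous (fun v : 'rV[R]_n => `|v 0 j|).
  by move=> v; exact: (cvg_norm (continuous_coord j v)).
have cdotp c : continuous (fun v => dotp c v).
  by apply: continuous_sumr => j; apply: scal; exact: continuous_coord.
have cdotp_norm c : continuous (fun v => dotp c (map_mx Num.norm v)).
  apply: continuous_sumr => j; apply: scal.
  by under eq_fun do rewrite mxE; exact: cabs.
by move=> v; exact: (cvgD (scal _ _ (cdotp _) v) (scal _ _ (cdotp_norm _) v)).
Qed.

(** The base value of the maximum also depends on the direction, so the
    induction runs over the list of indices with that base kept. *)
Lemma continuous_psi_phi x : continuous (psi_phi G x).
Proof.
rewrite /psi_phi; elim: (index_enum _) => [|i r IH].
  by under eq_fun do rewrite big_nil; exact: continuous_phi.
under eq_fun do rewrite big_cons.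
by move=> v; exact: (continuous_max (continuous_phi x i v) (IH v)).
Qed.

Lemma continuous_objective x : continuous (objective G x).
Proof.
have csqr : continuous (fun v : 'rV[R]_n => enorm v ^+ 2).
  under eq_fun do rewrite sqr_enorm.
  apply: continuous_sumr => j v.
  exact: (cvgM (continuous_coord j v) (continuous_coord j v)).
move=> v; apply: (cvgD (continuous_psi_phi x v)).
exact: (cvgM (cvg_cst _) (csqr v)).
Qed.

Lemma objective0 x : objective G x 0 = 0.
Proof.
rewrite /objective psi_phi0 sqr_enorm -(scale0r (0 : 'rV[R]_n)) dotpZr.
by rewrite mul0r mulr0 addr0.
Qed.

(** With [c] the midpoint of the gradient interval of [G_0], the objective is at
    least [c . v + |v|^2 / 2], so [objective G x v <= 0] forces
    [|v|^2 <= 2 |c| |v|]. *)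
Lemma objective_le0_bounded x :
  exists M : R, forall v, objective G x v <= 0 -> enorm v <= M.
Proof.
pose c := 2^-1 *: (gH_grad_lo (G ord0) x + gH_grad_hi (G ord0) x).
exists (2 * enorm c) => v; rewrite /objective => vle0.
have hphi : dotp c v <= psi_phi G x v.
  apply: le_trans (phi_le_psi_phi x v ord0).
  rewrite /phi /c dotpZl lerDl mulr_ge0// sumr_ge0// => j _.
  by rewrite !mxE mulr_ge0// subr_ge0 lo_le_hi.
have := dotp_le_enorm (- c) v; rewrite dotpNl enormN => hc.
have := enorm_ge0 v; rewrite le_eqVlt => /predU1P[<-|v0].
  by rewrite mulr_ge0// enorm_ge0.
have : 0 <= enorm v * (2 * enorm c - enorm v) by nra.
by rewrite pmulr_rge0// subr_ge0.
Qed.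

(** The sublevel set at height [objective G x 0 = 0] is nonempty and compact; a
    minimum over it is a global one. *)
Lemma objective_has_min x :
  exists v, forall u, objective G x v <= objective G x u.
Proof.
pose S := [set v | objective G x v <= 0].
have cS : compact S.
  have [M HM] := objective_le0_bounded x.
  apply: bounded_closed_compact.
    exists M; split; first exact: num_real.
    move=> B MB v /= Sv; rewrite (le_trans _ (ltW MB))//.
    rewrite (le_trans _ (HM _ Sv))//.
    rewrite [leLHS]/Num.Def.normr/= mx_normrE; apply/bigmax_leP; split.
      exact: enorm_ge0.
    by move=> [i j] _ /=; rewrite (ord1 i) ler_coord_enorm.
  have -> : S = objective G x @^-1` [set r | r <= 0] by [].
  apply: closed_comp; last exact: closed_le.
  by move=> v _; exact: continuous_objective.
have S0 : S !=set0 by exists 0; rewrite /S/= objective0.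
have [v vS vmin] := EVT_min_rV S0 cS
  (continuous_subspaceT (continuous_objective x)).
exists v => u; have [us|us] := leP (objective G x u) 0.
  by apply: vmin; rewrite inE.
by rewrite (le_trans _ (ltW us))//; move: vS; rewrite inE.
Qed.

(** Compare the minimizer with [0], where the objective vanishes. *)
Lemma psi_phi_vdir x :
  psi_phi G x (vdir G x) <= - (2^-1 * enorm (vdir G x) ^+ 2).
Proof.
have := xgetPex 0 (objective_has_min x) 0.
by rewrite -/(vdir G x) objective0 /objective; lra.
Qed.

(** Put [p = psi_phi G x d], [q = psi_phi G x' d] and [r = psi_phi G x' v].
    Sublinearity gives [- psi_phi G x' (v + b *: d) >= - r - b * q], and the
    choice of [b] means [b * (q - p) = eta * - r], that is
    [- b * q = - eta * - r + b * - p]. *)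
Lemma dai_yuan_descent (sigma eta : R) x x' v d :
  sigma < 1 -> 0 <= eta ->
  psi_phi G x d < 0 -> psi_phi G x' v <= 0 ->
  `|psi_phi G x' d| <= sigma * `|psi_phi G x d| ->
  let b := eta * (- psi_phi G x' v / (psi_phi G x' d - psi_phi G x d)) in
  0 <= b /\
  (1 - eta) * - psi_phi G x' v + b * - psi_phi G x d
    <= - psi_phi G x' (v + b *: d).
Proof.
have sub := psi_phi_sublinear x' v d.
move: (psi_phi G x d) (psi_phi G x' d) (psi_phi G x' v) sub => p q r sub.
move=> s1 e0 p0 r0 wolfe b.
have D0 : 0 < q - p.
  by move: wolfe; rewrite (ltr0_norm p0) ler_norml => /andP[h _]; nra.
have b0 : 0 <= b by rewrite mulr_ge0// divr_ge0 ?oppr_ge0// ltW.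
have bD : b * (q - p) = eta * - r by rewrite /b -mulrA divfK// gt_eqF.
split=> //; rewrite lerNr (le_trans (sub b b0))//.
by clearbody b; lra.
Qed.

(** The curvature condition forces [psi_phi G _ d] to grow by at least
    [(1 - sigma) * - psi_phi G x d] from [x] to [x'], while the Lipschitz bound
    limits that growth. *)
Lemma curvature_step (sigma K : R) x x' d (S : set 'rV[R]_n) :
  psi_phi G x d < 0 -> S x -> S x' ->
  (forall x y v, S x -> S y ->
    psi_phi G x v <= psi_phi G y v + K * enorm (x - y) * enorm v) ->
  `|psi_phi G x' d| <= sigma * `|psi_phi G x d| ->
  (1 - sigma) * - psi_phi G x d <= K * enorm (x' - x) * enorm d.
Proof.
move=> d0 Sx Sx' /(_ _ _ d Sx' Sx); move: d0.
move: (psi_phi G x d) (psi_phi G x' d) => p q p0 lip.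
by rewrite (ltr0_norm p0) ler_norml => /andP[h _]; lra.
Qed.

End SupportFunction.

(** * Recursions for real sequences *)

Lemma limn_einf_eq0 (R : realType) (u : nat -> R) :
  (forall k, 0 <= u k) ->
  (forall g : R, 0 < g -> forall N, exists2 k, (N <= k)%N & u k < g) ->
  limn_einf (fun k => (u k)%:E) = 0%E.
Proof.
move=> u0 ug; rewrite limn_einf_lim.
suff -> : einfs (fun k => (u k)%:E) = cst 0%E by exact: lim_cst.
apply/funext => N; apply/le_anti/andP; split.
  apply/lee_addgt0Pr => g g0; rewrite add0e.
  have [k Nk ukg] := ug _ g0 N.
  by apply: ge_ereal_inf; exists (u k)%:E; [exists k|rewrite lee_fin ltW].
by apply/ereal_infP => _ [k _ <-]; rewrite lee_fin.
Qed.

(** [B] is chosen so that [nd <= B * a] holds at [N] and [2 <= B * (c * g)].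
    The second property gives [nv <= B * (c * w)] from [N] on, because
    [w >= nv^2 / 2] and [nv >= g]; then [B] times the recursion for [a]
    dominates the recursion for [nd] term by term. *)
Lemma descent_ratio_bound (R : realType) (a w nv nd beta : nat -> R)
    (c g : R) N :
  0 < c -> 0 < g -> 0 < a N ->
  (forall k, 2^-1 * nv k ^+ 2 <= w k) ->
  (forall k, (N <= k)%N -> g <= nv k) ->
  (forall k, 0 <= beta k.+1) ->
  (forall k, c * w k.+1 + beta k.+1 * a k <= a k.+1) ->
  (forall k, nd k.+1 <= nv k.+1 + beta k.+1 * nd k) ->
  exists2 B, 0 < B & forall k, (N <= k)%N -> nd k <= B * a k.
Proof.
move=> c0 g0 aN w_ge nv_ge beta0 a_ge nd_le.
have cg0 : 0 < c * g by rewrite mulr_gt0.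
pose B := Num.max (nd N / a N) (2 / (c * g)).
have B0 : 0 < B by rewrite lt_max (divr_gt0 _ cg0) ?orbT.
have B_ge : 2 <= B * (c * g) by rewrite -ler_pdivrMr// le_max lexx orbT.
have B_start : nd N <= B * a N by rewrite -ler_pdivrMr// le_max lexx.
clearbody B; exists B => // k /subnKC <-.
elim: {k}(k - N)%N => [|k IH]; first by rewrite addn0.
rewrite addnS; set l := (N + k)%N in IH *.
have gl : g <= nv l.+1 by rewrite nv_ge// /l -addnS leq_addr.
have nv_small : nv l.+1 <= B * (c * w l.+1).
  have h1 := ler_wpM2l (ltW (mulr_gt0 B0 c0)) gl.
  have := ler_wpM2l (ltW (mulr_gt0 B0 c0)) (w_ge l.+1); nra.
have := ler_wpM2l (beta0 l) IH; have := ler_wpM2l (ltW B0) (a_ge l).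
have := nd_le l; lra.
Qed.

Lemma linear_decrease_unbounded (R : realType) (f : nat -> R) (e c : R) N :
  0 < e -> (forall k, (N <= k)%N -> f k.+1 <= f k - e) ->
  exists k, f k < c.
Proof.
move=> e0 fdec.
have lin k : f (N + k)%N <= f N - e * k%:R.
  elim: k => [|k IH]; first by rewrite addn0 mulr0 subr0.
  by have := fdec _ (leq_addr k N); rewrite addnS -natr1; lra.
have [k hk] : exists k : nat, `|f N - c| / e < k%:R.
  by exists (Num.bound (`|f N - c| / e)); rewrite archi_boundP// divr_ge0// ltW.
exists (N + k)%N; have := lin k.
move: hk; rewrite ltr_pdivrMr// => hk; have := ler_norm (f N - c); lra.
Qed.

(** * Convergence of the scheme *)

Theorem theorem4p4 (R : realType) (m n : nat) (rho sigma eta : R)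
    (G : 'I_m.+1 -> 'rV[R]_n -> cbi R)
    (x d : nat -> 'rV[R]_n) (t beta : nat -> R) :
  0 < rho -> rho < sigma -> sigma < 1 ->
  0 <= eta -> eta < (1 - sigma) / (1 + sigma) ->
  (forall i, gH_continuously_differentiable (G i)) ->
  ncg_scheme G x d t beta ->
  (forall i, exists L : R, gH_grad_lipschitz_on (level_set G (x 0%N)) L (G i)) ->
  (forall y : nat -> 'rV[R]_n,
     (forall k, level_set G (x 0%N) (y k)) ->
     (forall k i, cbi_le (G i (y k.+1)) (G i (y k))) ->
     exists calG : 'I_m.+1 -> cbi R, forall k i, cbi_le (calG i) (G i (y k))) ->
  (forall k, beta k.+1 = eta * betaDY G x d k) ->
  (forall k, strong_wolfe G rho sigma (x k) (d k) (t k)) ->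
  limn_einf (fun k => (enorm (vdir G (x k)))%:E) = 0%E.
Proof.
move=> rho0 rhosigma sigma1 eta0 eta_lt _ [d0 dS xS t0 nstop] lipG boundG betaE
  wolfe.
have sigma0 : 0 < sigma := lt_trans rho0 rhosigma.
have eta1 : eta < 1.
  by rewrite (lt_le_trans eta_lt)// ler_pdivrMr ?mul1r; lra.
pose v k := vdir G (x k).
have [a aE] : exists a : nat -> R, forall k, a k = - psi_phi G (x k) (d k).
  by exists (fun k => - psi_phi G (x k) (d k)).
have [w wE] : exists w : nat -> R, forall k, w k = - psi_phi G (x k) (v k).
  by exists (fun k => - psi_phi G (x k) (v k)).
have v_gt0 k : 0 < enorm (v k).
  rewrite lt_def enorm_ge0 andbT; apply/eqP => /enorm0_eq0 v0.
  by have [_ /eqP] := nstop k.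
have w_ge k : 2^-1 * enorm (v k) ^+ 2 <= w k.
  by rewrite wE lerNr psi_phi_vdir.
have w_gt0 k : 0 < w k.
  by rewrite (lt_le_trans _ (w_ge k))// mulr_gt0// exprn_gt0.
have curv k : `|psi_phi G (x k.+1) (d k)| <= sigma * `|psi_phi G (x k) (d k)|.
  by rewrite xS; have [] := wolfe k.
have step k : 0 < a k ->
    0 <= beta k.+1 /\ (1 - eta) * w k.+1 + beta k.+1 * a k <= a k.+1.
  rewrite !aE wE dS betaE oppr_gt0 => ak.
  apply: dai_yuan_descent (curv k) => //.
  by rewrite -oppr_ge0 -wE ltW// w_gt0.
have a_gt0 k : 0 < a k.
  elim: k => [|k ak]; first by rewrite aE d0 -wE w_gt0.
  have [bk] := step k ak; apply: lt_le_trans.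
  by rewrite ltr_pwDl ?(mulr_ge0 bk (ltW ak))// mulr_gt0 ?subr_gt0.
have armijo k i :
    lo (G i (x k.+1)) <= lo (G i (x k)) - rho * t k * a k /\
    hi (G i (x k.+1)) <= hi (G i (x k)) - rho * t k * a k.
  have [/(_ i) [/=]] := wolfe k.
  by rewrite -xS minxx maxxx aE !mulrN !opprK !(mulrC (psi_phi _ _ _)).
have dec k i : cbi_le (G i (x k.+1)) (G i (x k)).
  have [lok hik] := armijo k i.
  have r0 : 0 <= rho * t k * a k by rewrite !mulr_ge0// ltW.
  by split; [apply: le_trans lok _|apply: le_trans hik _]; rewrite gerBl.
have level k : level_set G (x 0%N) (x k).
  elim: k => [|k IH] i; first by split.
  have [lok hik] := IH i; have [lokS hikS] := dec k i.
  by split; [exact: le_trans lokS lok|exact: le_trans hikS hik].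
have [K K0 lipK] := psi_phi_lipschitz G _ lipG.
have [calG boundx] := boundG x level dec.
apply: limn_einf_eq0 => [k|g g0 N]; first exact: enorm_ge0.
apply: contrapT => nex.
have v_ge k : (N <= k)%N -> g <= enorm (v k).
  by move=> Nk; rewrite leNgt; apply/negP => vk; apply: nex; exists k.
have [B B0 d_le] : exists2 B, 0 < B &
    forall k, (N <= k)%N -> enorm (d k) <= B * a k.
  apply: (descent_ratio_bound _ a w (fun k => enorm (v k)) _ beta (1 - eta) g)
      => //.
  - by rewrite subr_gt0.
  - by move=> k; have [] := step k (a_gt0 k).
  - by move=> k; have [] := step k (a_gt0 k).
  - move=> k; have [b0 _] := step k (a_gt0 k).
    by rewrite dS (le_trans (enormD _ _))// enormZ ger0_norm.
have KB0 : 0 < K * B ^+ 2 by rewrite mulr_gt0// exprn_gt0.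
have e0 : 0 < rho * ((1 - sigma) / (K * B ^+ 2)).
  by rewrite mulr_gt0// divr_gt0// subr_gt0.
have drop k : (N <= k)%N -> lo (G ord0 (x k.+1)) <=
    lo (G ord0 (x k)) - rho * ((1 - sigma) / (K * B ^+ 2)).
  move=> Nk; have [h _] := armijo k ord0; apply: le_trans h _.
  rewrite lerD2l lerN2 -mulrA ler_pM2l// ler_pdivrMr//.
  have ak := a_gt0 k; rewrite aE oppr_gt0 in ak.
  have := curvature_step _ sigma _ _ _ _ _ ak (level k) (level k.+1) lipK.
  have -> : enorm (x k.+1 - x k) = t k * enorm (d k).
    by rewrite xS addrAC subrr add0r enormZ (gtr0_norm (t0 k)).
  rewrite -aE mulrA -mulrA -expr2 => /(_ (curv k)) h.
  have h1 : enorm (d k) ^+ 2 <= (B * a k) ^+ 2.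
    by rewrite ler_pXn2r ?nnegrE ?enorm_ge0 ?d_le// mulr_ge0// ltW.
  have h2 := ler_wpM2l (ltW (mulr_gt0 K0 (t0 k))) h1.
  rewrite -(ler_pM2r (a_gt0 k)) (le_trans h)// (le_trans h2)//.
  by rewrite le_eqVlt; apply/orP; left; apply/eqP; ring.
have [k] := linear_decrease_unbounded R (fun k => lo (G ord0 (x k))) _
  (lo (calG ord0)) _ e0 drop.
by rewrite ltNge; have [-> _] := boundx k ord0.
Qed.
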